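(* For any $n\geq 1$, the map $\psi:=\phi^{-1}\circ\chi^{-1}\circ\rho^{-1}$ is a poset isomorphism from the poset of Tamari intervals of size $n$ to the cubic coordinate poset $(\mathsf{CC}(n),\preccurlyeq)$.
   Context: For integers $i,j$, $[i,j]=\{i,i+1,\dots,j\}$ and $[i]=[1,i]$. Tamari intervals. A binary tree is either a leaf or a node attached to two binary trees, its left and right subtrees; its size is its number of nodes. The nodes of a binary tree of size $n$ are numbered $1,\dots,n$ in infix order (recursively: left subtree, then root, then right subtree). A right rotation of an edge $(k,l)$, where node $k$ is the left child of node $l$, locally replaces the configuration $((\mathfrak a,\mathfrak b),\mathfrak c)$ by $(\mathfrak a,(\mathfrak b,\mathfrak c))$, so that $l$ becomes the right child of $k$ (here $\mathfrak a,\mathfrak b$ are the left and right subtrees of $k$ and $\mathfrak c$ is the right subtree of $l$ before rotation). On binary trees of size $n$, $\mathfrak s\preccurlyeq_{\mathsf{ta}}\mathfrak t$ if $\mathfrak t$ is obtained from $\mathfrak s$ by zero or more right rotations (the Tamari order). A Tamari interval of size $n$ is a pair $(\mathfrak s,\mathfrak t)$ with $\mathfrak s\preccurlyeq_{\mathsf{ta}}\mathfrak t$. Tamari intervals of size $n$ are ordered by: $(\mathfrak s,\mathfrak t)\preccurlyeq(\mathfrak s',\mathfrak t')$ if $\mathfrak s\preccurlyeq_{\mathsf{ta}}\mathfrak s'$ and $\mathfrak t\preccurlyeq_{\mathsf{ta}}\mathfrak t'$. Interval-posets. An interval-poset of size $n$ is a partial order $\lhd$ on $\{\pi_1,\dots,\pi_n\}$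 such that for $i<j<k$: $\pi_k\lhd\pi_i$ implies $\pi_j\lhd\pi_i$, and $\pi_i\lhd\pi_k$ implies $\pi_j\lhd\pi_k$. The (known, due to Châtel and Pons) bijection $\rho$ sends an interval-poset to the Tamari interval $(\mathfrak s,\mathfrak t)$ where $\mathfrak s$ is the unique binary tree such that, for all $i<j$, node $j$ lies in the right subtree of node $i$ if and only if $\pi_j\lhd\pi_i$, and $\mathfrak t$ is the unique binary tree such that, for all $i<j$, node $i$ lies in the left subtree of node $j$ if and only if $\pi_i\lhd\pi_j$. Tamari interval diagrams. A Tamari diagram of size $n$ is a word $u$ of length $n$ on $\mathbb{N}=\{0,1,2,\dots\}$ such that $0\leq u_i\leq n-i$ for all $i\in[n]$ and $u_{i+j}\leq u_i-j$ for all $i\in[n]$, $j\in[0,u_i]$. A dual Tamari diagram of size $n$ is a word $v$ of length $n$ on $\mathbb{N}$ such that $0\leq v_i\leq i-1$ for all $i\in[n]$ and $v_{i-j}\leq v_i-j$ for all $i\in[n]$, $j\in[0,v_i]$. They are compatible if there are no $1\leq i<j\leq n$ with $u_i\geq j-i$ and $v_j\geq j-i$. $\mathsf{TID}(n)$ is the set of pairs $(u,v)$ of compatible Tamari and dual Tamari diagrams of size $n$. The bijection $\chi$ from $\mathsf{TID}(n)$ to interval-posets of size $n$ sends $(u,v)$ to the relation consisting of $\pi_{i+l}\lhd\pi_i$ for $i\in[n]$, $0\leq l\leq u_i$, and $\pi_{i-k}\lhd\pi_i$ for $i\in[n]$, $0\leq k\leq v_i$. Cubic coordinates. $\mathsf{CC}(n)$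 is the set of $(n-1)$-tuples of integers of the form $(u_1-v_2,u_2-v_3,\dots,u_{n-1}-v_n)$ with $(u,v)\in\mathsf{TID}(n)$. The bijection $\phi:\mathsf{CC}(n)\to\mathsf{TID}(n)$ sends $c$ to $(u,v)$ with $u_n=0$, $u_i=\max(c_i,0)$ for $i\in[n-1]$, $v_1=0$, $v_i=|\min(c_{i-1},0)|$ for $2\leq i\leq n$. The order on $\mathsf{CC}(n)$ is $c\preccurlyeq c'$ if and only if $c_i\leq c'_i$ for all $i\in[n-1]$. *)

(* Defs.v *)
(* Positions of words, nodes of trees and elements of interval-posets are
   numbered from 0, so that the index i of the usual 1-based conventions
   appears as i - 1 below. *)
From HB Require Import structures.
From Stdlib Require Export Relation_Operators.
From mathcomp Require Export all_boot all_order all_algebra.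
From mathcomp Require Export boolp classical_sets functions.

Set Implicit Arguments.
Unset Strict Implicit.
Unset Printing Implicit Defensive.

Import Order.TTheory GRing.Theory Num.Theory.

Local Open Scope classical_set_scope.

Inductive bintree : Type :=
  | Leaf
  | Node of bintree & bintree.

HB.instance Definition _ := gen_eqMixin bintree.
HB.instance Definition _ := gen_choiceMixin bintree.
HB.instance Definition _ := isPointed.Build bintree Leaf.

Fixpoint bsize (t : bintree) : nat :=
  if t is Node l r then (bsize l + bsize r).+1 else 0.

(* When the nodes of t are numbered o, o + 1, ... in infix order, the root of
   [Node l r] is o + bsize l, the nodes of l are o, ..., o + bsize l - 1 and
   those of r are o + bsize l + 1, ..., o + bsize l + bsize r.
   [in_right_from o t i j]: node j lies in the right subtree of node i;
   [in_left_from o t i j]: node i lies in the left subtree of node j. *)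
Fixpoint in_right_from (o : nat) (t : bintree) (i j : nat) : bool :=
  if t is Node l r then
    let k := o + bsize l in
    [|| (i == k) && (k < j <= k + bsize r),
        in_right_from o l i j | in_right_from k.+1 r i j]
  else false.

Fixpoint in_left_from (o : nat) (t : bintree) (i j : nat) : bool :=
  if t is Node l r then
    let k := o + bsize l in
    [|| (j == k) && (o <= i < k),
        in_left_from o l i j | in_left_from k.+1 r i j]
  else false.

Definition in_right := in_right_from 0.
Definition in_left := in_left_from 0.

Inductive right_rotation : bintree -> bintree -> Prop :=
  | rotation_root a b c :
      right_rotation (Node (Node a b) c) (Node a (Node b c))
  | rotation_left l l' r :
      right_rotation l l' -> right_rotation (Node l r) (Node l' r)
  | rotation_right l r r' :
      right_rotation r r' -> right_rotation (Node l r) (Node l r').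

Definition tamari_le : bintree -> bintree -> Prop :=
  clos_refl_trans bintree right_rotation.

Definition tamari_intervals (n : nat) : set (bintree * bintree) :=
  [set st | [/\ bsize st.1 = n, bsize st.2 = n & tamari_le st.1 st.2]].

Definition interval_le (st st' : bintree * bintree) : Prop :=
  tamari_le st.1 st'.1 /\ tamari_le st.2 st'.2.

(* [P a b] reads "pi_a is below pi_b". *)
Definition interval_posets (n : nat) : set ('I_n -> 'I_n -> bool) :=
  [set P | [/\ reflexive P, antisymmetric P, transitive P &
    forall i j k : 'I_n, i < j -> j < k ->
      (P k i -> P j i) /\ (P i k -> P j k)]].

(* [get] returns the element of a nonempty set and an arbitrary tree if the
   set is empty. *)
Definition rho (n : nat) (P : 'I_n -> 'I_n -> bool) : bintree * bintree :=
  (get (unique (fun s : bintree => bsize s = n /\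
          forall i j : 'I_n, i < j -> in_right s i j <-> P j i)),
   get (unique (fun t : bintree => bsize t = n /\
          forall i j : 'I_n, i < j -> in_left t i j <-> P i j))).

Definition tamari_diagram (n : nat) (u : n.-tuple nat) : Prop :=
  (forall i, i < n -> nth 0 u i <= n - i.+1) /\
  (forall i j, i < n -> j <= nth 0 u i -> nth 0 u (i + j) <= nth 0 u i - j).

Definition dual_tamari_diagram (n : nat) (v : n.-tuple nat) : Prop :=
  (forall i, i < n -> nth 0 v i <= i) /\
  (forall i j, i < n -> j <= nth 0 v i -> nth 0 v (i - j) <= nth 0 v i - j).

Definition compatible (n : nat) (u v : n.-tuple nat) : Prop :=
  ~ exists i j, [/\ i < j, j < n, j - i <= nth 0 u i & j - i <= nth 0 v j].

Definition TID (n : nat) : set (n.-tuple nat * n.-tuple nat) :=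
  [set uv | [/\ tamari_diagram uv.1, dual_tamari_diagram uv.2 &
                compatible uv.1 uv.2]].

Definition chi (n : nat) (uv : n.-tuple nat * n.-tuple nat) :
    'I_n -> 'I_n -> bool :=
  fun a b => [exists l : 'I_(nth 0 uv.1 b).+1, a == b + l :> nat] ||
             [exists k : 'I_(nth 0 uv.2 b).+1, a + k == b :> nat].

Definition cubic_of (n : nat) (uv : n.-tuple nat * n.-tuple nat) :
    n.-1.-tuple int :=
  [tuple ((nth 0 uv.1 i)%:Z - (nth 0 uv.2 i.+1)%:Z)%R | i < n.-1].

Definition CC (n : nat) : set (n.-1.-tuple int) := @cubic_of n @` @TID n.

Definition phi (n : nat) (c : n.-1.-tuple int) :
    n.-tuple nat * n.-tuple nat :=
  ([tuple if (i < n.-1)%N then `|Num.max (nth 0%R c i) 0%R|%N else 0 | i < n],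
   [tuple if (0 < i)%N then `|Num.min (nth 0%R c i.-1) 0%R|%N else 0 | i < n]).

Definition cubic_le (n : nat) (c c' : n.-1.-tuple int) : Prop :=
  forall i : 'I_n.-1, (tnth c i <= tnth c' i)%R.

(* Genuine inverses between the sets involved as soon as phi, chi and rho are
   bijections between these sets; off the image of a map, ['pinv_] returns the
   dummy default value. *)
Definition phi_inv (n : nat) : n.-tuple nat * n.-tuple nat -> n.-1.-tuple int :=
  'pinv_(fun=> [tuple of nseq n.-1 0%R]) (@CC n) (@phi n).

Definition chi_inv (n : nat) :
    ('I_n -> 'I_n -> bool) -> n.-tuple nat * n.-tuple nat :=
  'pinv_(fun=> ([tuple of nseq n 0], [tuple of nseq n 0])) (@TID n) (@chi n).

Definition rho_inv (n : nat) : bintree * bintree -> 'I_n -> 'I_n -> bool :=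
  'pinv_(fun=> fun _ _ => false) (@interval_posets n) (@rho n).

Definition psi (n : nat) : bintree * bintree -> n.-1.-tuple int :=
  @phi_inv n \o @chi_inv n \o @rho_inv n.

Definition poset_isomorphism (T U : Type) (A : set T) (leA : T -> T -> Prop)
    (B : set U) (leB : U -> U -> Prop) (f : T -> U) : Prop :=
  set_bij A B f /\
  forall x y, A x -> A y -> (leA x y <-> leB (f x) (f y)).

(* Main.v *)
Require Import Defs.
From mathcomp Require Import zify.

Set Implicit Arguments.
Unset Strict Implicit.
Unset Printing Implicit Defensive.

(** The whole statement becomes transparent once a binary tree is encoded by
    its bracket vector: the word listing, in infix order, the sizes of the right
    subtrees of the nodes ([rvec]), or dually of the left subtrees ([lvec]).

    - Right bracket vectors are exactly the Tamari diagrams, and determine the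
      tree ([rvec_bracket], [rvec_surj], [rvec_inj]); mirroring trees gives the
      same for left bracket vectors and dual Tamari diagrams.
    - A right rotation only enlarges the right bracket vector, and conversely
      the Tamari order is the pointwise order of right bracket vectors
      ([tamari_le_rvec], whose heart is [rotate_to_root]); it is also the
      reversed pointwise order of left bracket vectors ([tamari_le_lvec]).
    - For trees s and t of the same size, s is below t exactly when the right
      bracket vector of s and the left bracket vector of t are compatible
      ([tamari_le_compatible]).

    Hence pairing the right bracket vector of the lower bound with the left
    bracket vector of the upper bound identifies Tamari intervals with Tamari
    interval diagrams ([encodes_interval]). The tree relations that define
    [rho] are read off these two words, so this identification is the inverse
    of the composite of [rho] and [chi] ([rho_chi]), and [rho] is bijective
    because [chi] is; [chi] itself is inverted by recording how far the elements
    below a given one extend to the right and to the left of it.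

    Finally, the diagram of an interval is recovered from its cubic coordinates:
    by compatibility u_i and v_(i+1) are never both positive, so they are the
    positive and the negative part of their difference ([cubic_ofK]). Taking
    positive and negative parts is monotone and antitone, so comparing cubic
    coordinates amounts to comparing u pointwise and v pointwise backwards
    ([cubic_of_le]), which is the order of Tamari intervals by the second item
    above. *)

(** * Bracket vectors of binary trees *)

Fixpoint rvec (t : bintree) : seq nat :=
  if t is Node l r then rvec l ++ bsize r :: rvec r else [::].

Fixpoint lvec (t : bintree) : seq nat :=
  if t is Node l r then lvec l ++ bsize l :: lvec r else [::].

Fixpoint mirror (t : bintree) : bintree :=
  if t is Node l r then Node (mirror r) (mirror l) else Leaf.

(** Tamari diagrams in terms of reaches: i + u_i is the last node of the right
    subtree of i, and the condition says that the segments from i to i + u_i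
    form a laminar family. In this form the subtractions of truncated
    arithmetic disappear. *)
Definition bracket_vector (u : seq nat) : Prop :=
  forall i, i < size u -> i + nth 0 u i < size u /\
    forall j, i <= j -> j <= i + nth 0 u i -> j + nth 0 u j <= i + nth 0 u i.

Lemma size_rvec t : size (rvec t) = bsize t.
Proof.
by elim: t => //= l IHl r IHr; rewrite size_cat /= IHl IHr addnS.
Qed.

Lemma size_lvec t : size (lvec t) = bsize t.
Proof.
by elim: t => //= l IHl r IHr; rewrite size_cat /= IHl IHr addnS.
Qed.

Lemma bsize_mirror t : bsize (mirror t) = bsize t.
Proof. by elim: t => //= l -> r ->; rewrite addnC. Qed.

Lemma mirrorK : involutive mirror.
Proof. by elim=> //= l -> r ->. Qed.

Lemma rvec_mirror t : rvec (mirror t) = rev (lvec t).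
Proof.
elim: t => //= l IHl r IHr.
by rewrite IHl IHr rev_cat rev_cons cat_rcons bsize_mirror.
Qed.

Lemma nth_glue (a b : seq nat) x i :
  nth 0 (a ++ x :: b) i =
    if i < size a then nth 0 a i
    else if i == size a then x else nth 0 b (i - (size a).+1).
Proof.
rewrite nth_cat; case: ltnP => // hi; case: eqP => [->|hne].
  by rewrite subnn.
by rewrite (_ : i - size a = (i - (size a).+1).+1) //; lia.
Qed.

Lemma bracket_vector_glue (a b : seq nat) :
  bracket_vector a -> bracket_vector b -> bracket_vector (a ++ size b :: b).
Proof.
move=> ha hb i; rewrite size_cat /= nth_glue => hi.
have [ia|ai] := ltnP i (size a).
  have [h1 h2] := ha _ ia; split; first lia.
  move=> j ij ji; rewrite nth_glue (_ : j < size a = true); last lia.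
  exact: h2.
case: eqP => [->|ne]; split; try lia.
- move=> j ij ji; rewrite nth_glue ltnNge ij /=; case: eqP => [|jne]; first lia.
  have jb : j - (size a).+1 < size b by lia.
  by have [] := hb _ jb; lia.
- have ib : i - (size a).+1 < size b by lia.
  by have [] := hb _ ib; lia.
- have ib : i - (size a).+1 < size b by lia.
  have [_ h2] := hb _ ib => j ij ji.
  rewrite nth_glue ltnNge (leq_trans ai ij) /=.
  case: eqP => [|jne]; first lia.
  by have := h2 (j - (size a).+1); lia.
Qed.

Lemma rvec_bracket t : bracket_vector (rvec t).
Proof.
elim: t => [[]//|l IHl r IHr] /=.
by rewrite -size_rvec; exact: bracket_vector_glue.
Qed.

Lemma rvec_reach t i : i < bsize t -> i + nth 0 (rvec t) i < bsize t.
Proof. by rewrite -size_rvec => /rvec_bracket[]. Qed.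

Lemma lvec_le t j : nth 0 (lvec t) j <= j.
Proof.
elim: t j => [j|l IHl r IHr j] /=; first by rewrite nth_nil.
rewrite nth_glue size_lvec; have := IHl j; have := IHr (j - (bsize l).+1).
by case: ltnP => // ?; case: eqP => [->|] //; lia.
Qed.

(** The root is the first node whose right subtree extends to the last node, so
    its position, and then recursively the whole tree, can be read off the
    word. *)
Lemma rvec_inj : injective rvec.
Proof.
have root_first l r l' r' : rvec (Node l r) = rvec (Node l' r') ->
    bsize l' <= bsize l.
  move=> /= E; rewrite leqNgt; apply/negP => lt_ll'.
  have := congr1 size E; rewrite !size_cat /= !size_rvec => Es.
  have := congr1 (nth 0 ^~ (bsize l)) E.
  rewrite !nth_glue !size_rvec ltnn eqxx lt_ll' => Ek.
  by have := rvec_reach lt_ll'; lia.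
elim=> [|l IHl r IHr] [|l' r'] // E; try by have := congr1 size E;
  rewrite /= size_cat /= addnS.
have Ell' : bsize l = bsize l'.
  by apply/eqP; rewrite eqn_leq (root_first _ _ _ _ E) (root_first _ _ _ _ (esym E)).
move/eqP: E => /=; rewrite eqseq_cat ?size_rvec // => /andP[/eqP/IHl ->].
by rewrite eqseq_cons => /andP[_ /eqP/IHr ->].
Qed.

Lemma lvec_inj : injective lvec.
Proof.
move=> s t E; apply: (can_inj mirrorK); apply: rvec_inj.
by rewrite !rvec_mirror E.
Qed.

(** The inverse construction: cut the word at the first position k whose reach
    is the last position. By laminarity nothing before k reaches k, so both
    pieces are again bracket vectors. *)
Lemma rvec_surj u : bracket_vector u -> exists t, rvec t = u.
Proof.
elim/ltn_ind: {u}(size u) {-2}u (erefl (size u)) => n IH u En hu.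
case: (posnP n) => [n0|n_gt0].
  by exists Leaf; move: En; rewrite n0; case: (u).
have exk : exists k, (k < n) && (k + nth 0 u k == n.-1).
  by exists n.-1; have := hu n.-1; lia.
case: (ex_minnP exk) => k /andP[kn /eqP Ek] mink.
(* a node reaching k would reach the last position, as k does *)
have before i : i < k -> i + nth 0 u i < k.
  move=> ik; rewrite ltnNge; apply/negP => ki.
  have iu : i < size u by lia.
  have [h1 h2] := hu _ iu; have := h2 k (ltnW ik) ki.
  by have := mink i; lia.
have Eu : u = take k u ++ size (drop k.+1 u) :: drop k.+1 u.
  rewrite -[LHS](cat_take_drop k) (drop_nth 0) ?En // size_drop En.
  by congr (_ ++ _ :: _); lia.
have Etake : size (take k u) = k by rewrite size_take_min En; lia.
have [|l El] := IH k kn (take k u) Etake.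
  move=> i; rewrite Etake => ik; rewrite nth_take //; split; first exact: before.
  move=> j ij ji; have := before _ ik => bi.
  rewrite nth_take; last lia.
  by have [] := hu i; [lia | move=> _; exact].
have Edrop : size (drop k.+1 u) = n - k.+1 by rewrite size_drop En.
have lt_drop : n - k.+1 < n by lia.
have [|r Er] := IH _ lt_drop _ Edrop.
  move=> i; rewrite Edrop => ik; rewrite nth_drop.
  have [|h1 h2] := hu (k.+1 + i); first lia.
  split=> [|j ij ji]; first lia.
  by rewrite nth_drop; have := h2 (k.+1 + j); lia.
by exists (Node l r); rewrite /= El Er -size_rvec Er -Eu.
Qed.

(** * Subtree relations read off bracket vectors *)

Lemma in_right_fromE o t i j : in_right_from o t i j =
  (o <= i < o + bsize t) && (i < j <= i + nth 0 (rvec t) (i - o)).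
Proof.
elim: t o => [|l IHl r IHr] o /=; first by rewrite nth_nil; lia.
rewrite IHl IHr nth_glue size_rvec.
rewrite (_ : i - o - (bsize l).+1 = i - (o + bsize l).+1); last lia.
have [io|oi] := ltnP i o; first by lia.
rewrite (_ : (i - o < bsize l) = (i < o + bsize l)); last lia.
rewrite (_ : (i - o == bsize l) = (i == o + bsize l)); last lia.
have [h|h] := ltnP i (o + bsize l); first lia.
by have [h'|h'] := eqVneq i (o + bsize l); lia.
Qed.

Lemma in_left_fromE o t i j : in_left_from o t i j =
  (o <= j < o + bsize t) && (i < j <= i + nth 0 (lvec t) (j - o)).
Proof.
elim: t o => [|l IHl r IHr] o /=; first by rewrite nth_nil; lia.
rewrite IHl IHr nth_glue size_lvec.
rewrite (_ : j - o - (bsize l).+1 = j - (o + bsize l).+1); last lia.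
have [jo|oj] := ltnP j o; first by lia.
rewrite (_ : (j - o < bsize l) = (j < o + bsize l)); last lia.
rewrite (_ : (j - o == bsize l) = (j == o + bsize l)); last lia.
have [h|h] := ltnP j (o + bsize l); first lia.
by have [h'|h'] := eqVneq j (o + bsize l); lia.
Qed.

Lemma in_rightE t i j : i < bsize t ->
  in_right t i j = (i < j <= i + nth 0 (rvec t) i).
Proof. by move=> it; rewrite /in_right in_right_fromE subn0 /= it. Qed.

Lemma in_leftE t i j : j < bsize t ->
  in_left t i j = (i < j <= i + nth 0 (lvec t) j).
Proof. by move=> jt; rewrite /in_left in_left_fromE subn0 /= jt. Qed.

(** A node of the right subtree of i is a proper descendant of i, and a node
    whose left subtree contains i is a proper ancestor of i. *)
Lemma not_right_and_left t i j : i < j -> j < bsize t ->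
  j - i <= nth 0 (rvec t) i -> j - i <= nth 0 (lvec t) j -> False.
Proof.
elim: t i j => [//|l IHl r IHr] i j ij /=.
rewrite !nth_glue size_rvec size_lvec => jn.
have [jl|lj] := ltnP j (bsize l); first by rewrite (ltn_trans ij jl); exact: IHl.
have [il|li] := ltnP i (bsize l); first by have := rvec_reach il; lia.
have := lvec_le r (j - (bsize l).+1).
have [Ei|ni] := eqVneq i (bsize l); have [Ej|nj] := eqVneq j (bsize l); try lia.
move=> _ h1 h2; apply: (IHr (i - (bsize l).+1) (j - (bsize l).+1)); lia.
Qed.

(** The node that follows the right subtree of i in infix order is the lowest
    ancestor of i having i in its left subtree. *)
Lemma left_of_next t i : (i + nth 0 (rvec t) i).+1 < bsize t ->
  nth 0 (rvec t) i < nth 0 (lvec t) (i + nth 0 (rvec t) i).+1.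
Proof.
elim: t i => [//|l IHl r IHr] i /=.
rewrite !nth_glue size_rvec size_lvec.
have [il _|li] := ltnP i (bsize l).
  have reach := rvec_reach il.
  have [lt|ge] := ltnP (i + nth 0 (rvec l) i).+1 (bsize l); first exact: IHl.
  by case: eqP; lia.
have [->|ne] := eqVneq i (bsize l); first lia.
move=> lt; set x := nth 0 (rvec r) _ in lt *.
rewrite (_ : ((i + x).+1 < bsize l) = false); last lia.
rewrite (_ : ((i + x).+1 == bsize l) = false); last lia.
have := IHr (i - (bsize l).+1); rewrite -/x.
rewrite (_ : (i - (bsize l).+1 + x).+1 = (i + x).+1 - (bsize l).+1); last lia.
by apply; lia.
Qed.

(** * The Tamari order as an order of bracket vectors *)

Lemma bsize_rotation s t : right_rotation s t -> bsize s = bsize t.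
Proof. by elim=> /= *; lia. Qed.

Lemma tamari_le_bsize s t : tamari_le s t -> bsize s = bsize t.
Proof. by elim=> [x y /bsize_rotation| |x y z _ -> _ ->]. Qed.

Lemma tamari_le_node l l' r r' :
  tamari_le l l' -> tamari_le r r' -> tamari_le (Node l r) (Node l' r').
Proof.
move=> hl hr; apply: (@rt_trans _ _ _ (Node l' r)).
  elim: hl => [x y h|x|x y z _ h1 _ h2]; last exact: rt_trans h1 h2.
    by apply/rt_step/rotation_left.
  exact: rt_refl.
elim: hr => [x y h|x|x y z _ h1 _ h2]; last exact: rt_trans h1 h2.
  by apply/rt_step/rotation_right.
exact: rt_refl.
Qed.

Lemma mirror_rotation s t :
  right_rotation s t -> right_rotation (mirror t) (mirror s).
Proof. by elim=> /= *; constructor. Qed.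

Lemma tamari_le_mirror s t : tamari_le s t <-> tamari_le (mirror t) (mirror s).
Proof.
(* mirroring is an involution, so one direction suffices *)
have half x y : tamari_le x y -> tamari_le (mirror y) (mirror x).
  elim=> [? ? h|?|a b c _ h1 _ h2]; last exact: rt_trans h2 h1.
    by apply/rt_step/mirror_rotation.
  exact: rt_refl.
by split=> [/half //|/half]; rewrite !mirrorK.
Qed.

Lemma rvec_rotation s t : right_rotation s t ->
  forall i, nth 0 (rvec s) i <= nth 0 (rvec t) i.
Proof.
elim=> [a b c|l l' r /[dup] h /bsize_rotation E IH|
        l r r' /[dup] h /bsize_rotation E IH] i /=.
- rewrite -catA cat_cons !nth_glue.
  by case: ltnP => // ?; case: eqP => // ?; lia.
- rewrite !nth_glue !size_rvec E; case: ltnP => // _; exact: IH.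
- rewrite !nth_glue !size_rvec E; case: ltnP => // _; by case: eqP.
Qed.

(** If node k lies in the right subtree of no earlier node, then it is on the
    left branch of s, and rotating successively the edges that lead to k brings
    it to the root. Only node k gets a new right subtree, so the bracket vector
    changes at position k only; this is what keeps the result below any upper
    bound whose root is at position k. *)
Lemma rotate_to_root s k : k < bsize s ->
    (forall i, i < k -> i + nth 0 (rvec s) i < k) ->
  exists l r a, [/\ tamari_le s (Node l r), bsize l = k &
                    rvec s = rvec l ++ a :: rvec r].
Proof.
elim: s => [//|l IHl r _] /= kn before.
(* otherwise k would be in the right subtree of the root *)
have kl : k <= bsize l.
  rewrite leqNgt; apply/negP => lk; have := before _ lk.
  by rewrite nth_glue size_rvec ltnn eqxx; lia.
have [<-|ne] := eqVneq (bsize l) k.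
  by exists l, r, (bsize r); split=> //; exact: rt_refl.
have {}kl : k < bsize l by lia.
have [|l1 [l2 [a [le_l El1 Evec]]]] := IHl kl.
  move=> i ik; have := before _ ik; rewrite nth_glue size_rvec.
  by rewrite (ltn_trans ik kl).
exists l1, (Node l2 r), a; split=> //; last by rewrite /= Evec -catA.
apply: (@rt_trans _ _ _ (Node (Node l1 l2) r)).
  by apply: tamari_le_node => //; exact: rt_refl.
exact/rt_step/rotation_root.
Qed.

(** For the non-trivial direction, let k be the position of the root of t. No
    node before k reaches k in t, hence none does in s, so s can be rotated to a
    tree with root k; its two subtrees are then handled by induction. *)
Lemma tamari_le_rvec s t : bsize s = bsize t ->
  (forall i, nth 0 (rvec s) i <= nth 0 (rvec t) i) <-> tamari_le s t.
Proof.
move=> Est; split=> [le_st|].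
  elim: t s Est le_st => [|tl IHl tr IHr] s /= Est le_st.
    by case: s Est le_st => // *; exact: rt_refl.
  have [||l [r [a [le_s El Evec]]]] := @rotate_to_root s (bsize tl).
  - by rewrite Est; lia.
  - move=> i ik; have := le_st i; rewrite nth_glue size_rvec ik.
    by have := rvec_reach ik; lia.
  have Er : bsize r = bsize tr.
    by have := tamari_le_bsize le_s; rewrite /= Est El; lia.
  apply: (rt_trans _ _ _ _ _ le_s); apply: tamari_le_node.
    apply: IHl => // i; have := le_st i; rewrite Evec !nth_glue !size_rvec El.
    by case: ltnP => // h _; rewrite nth_default // size_rvec El.
  apply: IHr => // i; have := le_st (bsize tl + i.+1).
  rewrite Evec !nth_glue !size_rvec El ltnNge leq_addr /=.
  rewrite (_ : (_ == _) = false); last lia.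
  by rewrite -addSnnS addKn.
elim=> [x y /rvec_rotation //|//|x y z _ h1 _ h2] i.
exact: leq_trans (h1 i) (h2 i).
Qed.

(** Mirroring trees reverses both the Tamari order and the words. *)
Lemma tamari_le_lvec s t : bsize s = bsize t ->
  (forall i, nth 0 (lvec t) i <= nth 0 (lvec s) i) <-> tamari_le s t.
Proof.
move=> Est; rewrite tamari_le_mirror -tamari_le_rvec ?bsize_mirror //.
rewrite !rvec_mirror; split=> le_ts i.
  have [it|ti] := ltnP i (bsize t).
    by rewrite !nth_rev ?size_lvec ?Est //; exact: le_ts.
  by rewrite nth_default // size_rev size_lvec.
have [it|ti] := ltnP i (bsize t); last by rewrite nth_default // size_lvec.
have jt : bsize t - i.+1 < bsize t by lia.
have := le_ts (bsize t - i.+1); rewrite !nth_rev ?size_lvec ?Est //.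
by rewrite (_ : bsize t - (bsize t - i.+1).+1 = i) //; lia.
Qed.

(** If s is not below t, some node i has a larger right subtree in s than in t.
    The node j that follows the right subtree of i in t then violates
    compatibility: i is to its left in t, and it is to the right of i in s. *)
Lemma tamari_le_compatible s t : bsize s = bsize t ->
  tamari_le s t <->
  ~ exists i j, [/\ i < j, j < bsize s, j - i <= nth 0 (rvec s) i &
                    j - i <= nth 0 (lvec t) j].
Proof.
move=> Est; rewrite -tamari_le_rvec //; split.
  move=> le_st [i [j [ij js ui vj]]]; rewrite Est in js.
  exact: (not_right_and_left ij js (leq_trans ui (le_st i)) vj).
move=> compat i; rewrite leqNgt; apply/negP => lt_ts; apply: compat.
have si : i < bsize s.
  rewrite -size_rvec ltnNge; apply/negP => h.
  by rewrite (nth_default 0 h) in lt_ts.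
have := rvec_reach si => reach_s.
exists i, (i + nth 0 (rvec t) i).+1; have := @left_of_next t i.
by split; lia.
Qed.

(** * Tamari interval diagrams and Tamari intervals *)

Lemma tamari_diagramP n (u : n.-tuple nat) :
  tamari_diagram u <-> bracket_vector u.
Proof.
rewrite /bracket_vector size_tuple; split=> [[h1 h2] i ni|h].
  have := h1 i ni; split=> [|j ij ji]; first lia.
  by have := h2 i (j - i) ni; rewrite subnKC //; lia.
split=> [i ni|i j ni ji]; have [h1 h2] := h i ni; first lia.
by have := h2 (i + j); lia.
Qed.

Lemma dual_tamari_diagramP n (v : n.-tuple nat) :
  dual_tamari_diagram v <-> bracket_vector (rev v).
Proof.
rewrite /bracket_vector size_rev size_tuple; split=> [[h1 h2] i ni|h].
  rewrite nth_rev ?size_tuple //; have := h1 (n - i.+1) => h1i.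
  split=> [|j ij ji]; first lia.
  rewrite nth_rev ?size_tuple; last lia.
  have := h2 (n - i.+1) (j - i).
  by rewrite (_ : n - i.+1 - (j - i) = n - j.+1); lia.
have h' i : i < n -> nth 0 v i <= i /\
    forall j, j <= nth 0 v i -> nth 0 v (i - j) <= nth 0 v i - j.
  move=> ni; have ni' : n - i.+1 < n by lia.
  have [] := h (n - i.+1) ni'.
  rewrite nth_rev ?size_tuple // (_ : n - (n - i.+1).+1 = i); last lia.
  move=> h1 h2; split=> [|j jv]; first lia.
  have := h2 (n - i.+1 + j); rewrite nth_rev ?size_tuple; last lia.
  by rewrite (_ : n - (n - i.+1 + j).+1 = i - j); lia.
by split=> [i /h' []|i j /h' [_ h2]] //; exact: h2.
Qed.

(** Each half of the diagram comes from a different bound: the right subtrees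
    of the lower one and the left subtrees of the upper one. *)
Definition encodes n (uv : n.-tuple nat * n.-tuple nat)
    (st : bintree * bintree) : Prop :=
  rvec st.1 = uv.1 /\ lvec st.2 = uv.2.

Lemma encodes_bsize n (uv : n.-tuple nat * n.-tuple nat) st :
  encodes uv st -> bsize st.1 = n /\ bsize st.2 = n.
Proof.
by case=> E1 E2; rewrite -size_rvec -size_lvec E1 E2 !size_tuple.
Qed.

Lemma encodes_inj n (uv uv' : n.-tuple nat * n.-tuple nat) st st' :
  encodes uv st -> encodes uv' st' -> uv = uv' <-> st = st'.
Proof.
case: uv uv' st st' => [u v] [u' v'] [s t] [s' t'] [/= E1 E2] [/= E1' E2'].
split=> [][] Ea Eb.
  by congr pair; [apply: rvec_inj; rewrite E1 E1' Ea
                |apply: lvec_inj; rewrite E2 E2' Eb].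
by congr pair; apply: val_inj; rewrite /= -?E1 -?E1' -?E2 -?E2' ?Ea ?Eb.
Qed.

Lemma encodes_interval n (uv : n.-tuple nat * n.-tuple nat) st :
  encodes uv st -> TID uv <-> tamari_intervals n st.
Proof.
move=> /[dup] /encodes_bsize [Es Et] [E1 E2].
have compatP : tamari_le st.1 st.2 <-> compatible uv.1 uv.2.
  by rewrite tamari_le_compatible ?Es ?Et // E1 E2.
split=> [[_ _ /compatP]|[_ _ /compatP]] //; split=> //.
  by apply/tamari_diagramP; rewrite -E1; exact: rvec_bracket.
by apply/dual_tamari_diagramP; rewrite -E2 -rvec_mirror; exact: rvec_bracket.
Qed.

Lemma TID_encodes n (uv : n.-tuple nat * n.-tuple nat) :
  TID uv -> exists st, encodes uv st.
Proof.
case=> /tamari_diagramP/rvec_surj[s Es] /dual_tamari_diagramP/rvec_surj[t Et] _.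
exists (s, mirror t); split=> //=.
by rewrite -[LHS]revK -rvec_mirror mirrorK Et revK.
Qed.

Lemma encodes_exists n st : bsize st.1 = n -> bsize st.2 = n ->
  exists uv : n.-tuple nat * n.-tuple nat, encodes uv st.
Proof.
move=> Es Et.
have szu : size (rvec st.1) == n by rewrite size_rvec Es.
have szv : size (lvec st.2) == n by rewrite size_lvec Et.
by exists (Tuple szu, Tuple szv).
Qed.

(** * Tamari interval diagrams and interval-posets *)

Lemma chiE n (uv : n.-tuple nat * n.-tuple nat) (a b : 'I_n) :
  chi uv a b = (b <= a <= b + nth 0 uv.1 b) || (a <= b <= a + nth 0 uv.2 b).
Proof.
rewrite /chi; congr orb; apply/existsP/idP => [[l /eqP E]|/andP[h1 h2]].
- by have := ltn_ord l; lia.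
- have h : a - b < (nth 0 uv.1 b).+1 by lia.
  by exists (Ordinal h); apply/eqP => /=; lia.
- by have := ltn_ord l; lia.
- have h : b - a < (nth 0 uv.2 b).+1 by lia.
  by exists (Ordinal h); apply/eqP => /=; lia.
Qed.

(** Each word on its own gives a transitive relation by laminarity. When steps
    in opposite directions are composed, compatibility prevents the second
    segment from coming back over the first element. *)
Lemma chi_interval_poset n (uv : n.-tuple nat * n.-tuple nat) :
  TID uv -> interval_posets (chi uv).
Proof.
case: uv => u v [[/= u1 u2] [v1 v2] compat].
have {}compat i j : i < j -> j < n ->
    j <= i + nth 0 u i -> j <= i + nth 0 v j -> False.
  by move=> *; apply: compat; exists i, j; split; lia.
have {}u2 i j : i < n -> i <= j -> j <= i + nth 0 u i ->
    j + nth 0 u j <= i + nth 0 u i.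
  by move=> ni ij ji; have := u2 i (j - i) ni; rewrite subnKC //; lia.
have {}v2 i j : i < n -> j <= i -> i <= j + nth 0 v i ->
    i + nth 0 v j <= j + nth 0 v i.
  move=> ni ij ji; have := v1 i ni; have := v2 i (i - j) ni.
  by rewrite subKn //; lia.
split=> [a|a b|b a c|i j k ij jk]; rewrite !chiE /=; first lia.
- have := compat a b; have := compat b a; have := ltn_ord a; have := ltn_ord b.
  by move=> bn an c1 c2 h; apply: val_inj => /=; lia.
- have an := ltn_ord a; have bn := ltn_ord b; have cn := ltn_ord c.
  have := v2 c b cn; have := u2 c b cn; have := compat c b; have := compat b c.
  by lia.
- by lia.
Qed.

(** The elements below b form a segment, whose ends are the positions b - v_b
    and b + u_b. *)
Lemma chi_inj n (uv uv' : n.-tuple nat * n.-tuple nat) :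
  TID uv -> TID uv' -> chi uv = chi uv' -> uv = uv'.
Proof.
have half (x y : n.-tuple nat * n.-tuple nat) (b : 'I_n) :
    TID x -> chi x = chi y ->
    nth 0 x.1 b <= nth 0 y.1 b /\ nth 0 x.2 b <= nth 0 y.2 b.
  move=> [[u1 _] [v1 _] _] E.
  have bn := ltn_ord b; have ub := u1 b bn; have vb := v1 b bn.
  split.
    have h : b + nth 0 x.1 b < n by lia.
    have := congr1 (fun f => f (Ordinal h) b) E; rewrite !chiE /=.
    by lia.
  have h : b - nth 0 x.2 b < n by lia.
  have := congr1 (fun f => f (Ordinal h) b) E; rewrite !chiE /=.
  by lia.
case: uv uv' => [u v] [u' v'] T T' E.
by congr pair; apply: eq_from_tnth => i; rewrite !(tnth_nth 0);
  have := half _ _ i T E; have := half _ _ i T' (esym E); move=> /=; lia.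
Qed.

(** By the interval condition the elements below b form a segment around b;
    its extents to the right and to the left of b give u_b and v_b. *)
Lemma chi_surj n (P : 'I_n -> 'I_n -> bool) :
  interval_posets P -> exists2 uv, TID uv & chi uv = P.
Proof.
case=> Prefl Panti Ptrans Pint.
pose U (b : 'I_n) := \max_(a : 'I_n | P a b) (a - b).
pose V (b : 'I_n) := \max_(a : 'I_n | P a b) (b - a).
have Ule (a b : 'I_n) : P a b -> a - b <= U b by exact: leq_bigmax_cond.
have Vle (a b : 'I_n) : P a b -> b - a <= V b by exact: leq_bigmax_cond.
have Pne (b : 'I_n) : 0 < #|[pred a | P a b]|.
  by apply/card_gt0P; exists b; rewrite inE Prefl.
have Umax (b : 'I_n) : exists2 a : 'I_n, P a b & U b = a - b.
  by have [a] := eq_bigmax_cond (fun a : 'I_n => a - b) (Pne b); exists a.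
have Vmax (b : 'I_n) : exists2 a : 'I_n, P a b & V b = b - a.
  by have [a] := eq_bigmax_cond (fun a : 'I_n => b - a) (Pne b); exists a.
have PU (a b : 'I_n) : b <= a -> P a b = (a <= b + U b).
  move=> ba; apply/idP/idP => [/Ule|]; first lia.
  have [c Pcb ->] := Umax b => h.
  have [->|ab] := eqVneq a b; first exact: Prefl.
  have [->|ac] := eqVneq a c; first exact: Pcb.
  have ltba : b < a by move: ab; rewrite -val_eqE /=; lia.
  have ltac : a < c by move: ac; rewrite -val_eqE /=; lia.
  by have [h1 _] := Pint b a c ltba ltac; exact: h1.
have PV (a b : 'I_n) : a <= b -> P a b = (b <= a + V b).
  move=> ba; apply/idP/idP => [/Vle|]; first lia.
  have [c Pcb ->] := Vmax b => h.
  have [->|ab] := eqVneq a b; first exact: Prefl.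
  have [->|ac] := eqVneq a c; first exact: Pcb.
  have ltab : a < b by move: ab; rewrite -val_eqE /=; lia.
  have ltca : c < a by move: ac; rewrite -val_eqE /=; lia.
  by have [_ h2] := Pint c a b ltca ltab; exact: h2.
have Ubound (b : 'I_n) : b + U b < n.
  by have [a _ ->] := Umax b; have := ltn_ord a; have := ltn_ord b; lia.
have Vbound (b : 'I_n) : V b <= b by have [a _ ->] := Vmax b; lia.
pose uv : n.-tuple nat * n.-tuple nat := ([tuple U i | i < n], [tuple V i | i < n]).
have nthU (b : 'I_n) : nth 0 uv.1 b = U b by rewrite -tnth_nth tnth_mktuple.
have nthV (b : 'I_n) : nth 0 uv.2 b = V b by rewrite -tnth_nth tnth_mktuple.
exists uv; last first.
  apply/funext => a; apply/funext => b; rewrite chiE nthU nthV.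
  have [ab|ba|ab] := ltngtP a b.
  - by rewrite /= -PV // ltnW.
  - by rewrite /= orbF -PU // ltnW.
  - by rewrite (val_inj ab) leq_addr Prefl.
split; first split.
- move=> i ni; rewrite (nthU (Ordinal ni)).
  by have := Ubound (Ordinal ni) => /=; lia.
- move=> i j ni; rewrite (nthU (Ordinal ni)) => jU.
  have nij : i + j < n by have := Ubound (Ordinal ni) => /=; lia.
  rewrite (nthU (Ordinal nij)).
  have [a Pa Ea] := Umax (Ordinal nij).
  have Pji : P (Ordinal nij) (Ordinal ni) by rewrite PU //=; lia.
  by have := Ule _ _ (Ptrans _ _ _ Pa Pji); rewrite Ea /=; lia.
- split=> [i ni|i j ni].
    by rewrite (nthV (Ordinal ni)); exact: Vbound (Ordinal ni).
  rewrite (nthV (Ordinal ni)) => jV.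
  have ji : j <= i := leq_trans jV (Vbound (Ordinal ni)).
  have nij : i - j < n by lia.
  rewrite (nthV (Ordinal nij)).
  have [a Pa Ea] := Vmax (Ordinal nij).
  have Pji : P (Ordinal nij) (Ordinal ni) by rewrite PV //=; lia.
  by have := Vle _ _ (Ptrans _ _ _ Pa Pji); rewrite Ea /=; lia.
- move=> [i [j [ij nj]]]; have ni := ltn_trans ij nj.
  rewrite (nthU (Ordinal ni)) (nthV (Ordinal nj)) => hU hV.
  have Pji : P (Ordinal nj) (Ordinal ni) by rewrite PU /=; lia.
  have Pij : P (Ordinal ni) (Ordinal nj) by rewrite PV /=; lia.
  have /(congr1 val) /= := Panti (Ordinal ni) (Ordinal nj) (introT andP (conj Pij Pji)).
  by lia.
Qed.

Lemma get_unique (T : pointedType) (Q : T -> Prop) x :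
  unique Q x -> get (unique Q) = x.
Proof. by move=> Qx; have [_] := getPex (ex_intro _ x Qx); apply; case: Qx. Qed.

(** Both predicates in the definition of [rho] prescribe a bracket vector, so
    each has exactly one solution. *)
Lemma rho_chi n (uv : n.-tuple nat * n.-tuple nat) st :
  TID uv -> encodes uv st -> rho (chi uv) = st.
Proof.
move=> T /[dup] /encodes_bsize[Es Et] [E1 E2].
have [[u1 _] [v1 _] _] := T.
rewrite /rho [RHS]surjective_pairing; congr pair; apply: get_unique; split.
- split=> // i j ij; rewrite in_rightE ?Es // E1 chiE.
  by split; lia.
- move=> s [Es' hs]; apply: rvec_inj; apply: (@eq_from_nth _ 0).
    by rewrite !size_rvec Es Es'.
  move=> i; rewrite size_rvec Es => ni.
  have ni' : i < bsize s by rewrite Es'.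
  have R j (nj : j < n) : i < j ->
      (j <= i + nth 0 (rvec s) i) <-> (j <= i + nth 0 (rvec st.1) i).
    move=> ij; have := hs (Ordinal ni) (Ordinal nj) ij.
    rewrite in_rightE // chiE /= E1 => -[h1 h2]; split=> h.
      by have := h1; lia.
    by have := h2; lia.
  have := rvec_reach ni'; rewrite Es'; have := u1 i ni; rewrite -E1.
  have := R (i + nth 0 (rvec s) i); have := R (i + nth 0 (rvec st.1) i).
  by lia.
- split=> // i j ij; rewrite in_leftE ?Et // E2 chiE.
  by split; lia.
- move=> t [Et' ht]; apply: lvec_inj; apply: (@eq_from_nth _ 0).
    by rewrite !size_lvec Et Et'.
  move=> j; rewrite size_lvec Et => nj.
  have nj' : j < bsize t by rewrite Et'.
  have L i (ni : i < n) : i < j ->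
      (j <= i + nth 0 (lvec t) j) <-> (j <= i + nth 0 (lvec st.2) j).
    move=> ij; have := ht (Ordinal ni) (Ordinal nj) ij.
    rewrite in_leftE // chiE /= E2 => -[h1 h2]; split=> h.
      by have := h1; lia.
    by have := h2; lia.
  have := lvec_le t j; have := lvec_le st.2 j.
  have := L (j - nth 0 (lvec t) j); have := L (j - nth 0 (lvec st.2) j).
  by lia.
Qed.

(** * Cubic coordinates *)

Lemma TID_adjacent n (uv : n.-tuple nat * n.-tuple nat) i :
  TID uv -> i.+1 < n -> nth 0 uv.1 i = 0 \/ nth 0 uv.2 i.+1 = 0.
Proof.
move=> [_ _ compat] ni; case: (posnP (nth 0 uv.1 i)); first by left.
case: (posnP (nth 0 uv.2 i.+1)); first by right.
by move=> hv hu; case: compat; exists i, i.+1; split; lia.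
Qed.

Lemma nth_cubic_of n (uv : n.-tuple nat * n.-tuple nat) i : i < n.-1 ->
  nth 0%R (cubic_of uv) i = ((nth 0%N uv.1 i)%:Z - (nth 0%N uv.2 i.+1)%:Z)%R.
Proof.
by move=> ni; rewrite (nth_map (Ordinal ni)) ?size_enum_ord // nth_enum_ord.
Qed.

Lemma abs_max_sub (a b : nat) : `|Num.max (a%:Z - b%:Z)%R 0%R|%N = a - b.
Proof. by rewrite Order.POrderTheory.maxEle; case: ifP; lia. Qed.

Lemma abs_min_sub (a b : nat) : `|Num.min (a%:Z - b%:Z)%R 0%R|%N = b - a.
Proof. by rewrite Order.POrderTheory.minEle; case: ifP; lia. Qed.

Lemma cubic_ofK n (uv : n.-tuple nat * n.-tuple nat) :
  TID uv -> phi (cubic_of uv) = uv.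
Proof.
move=> T; have [[u1 _] [v1 _] _] := T.
rewrite /phi [RHS]surjective_pairing; congr pair; apply: eq_from_tnth => i;
  rewrite tnth_mktuple (tnth_nth 0); have ni := ltn_ord i.
  case: ltnP => h; last by have := u1 i ni; lia.
  have h' : i.+1 < n by lia.
  by rewrite nth_cubic_of // abs_max_sub; have := TID_adjacent T h'; lia.
case: posnP => h; first by have := v1 i ni; lia.
have h' : i.-1.+1 < n by lia.
rewrite nth_cubic_of ?abs_min_sub; last lia.
by have := TID_adjacent T h'; rewrite prednK //; lia.
Qed.

(** Since u_i or v_(i+1) vanishes, u_i and v_(i+1) are the positive and negative
    parts of the i-th cubic coordinate. The remaining entries, the last one of u
    and the first one of v, are always 0. *)
Lemma cubic_of_le n (uv uv' : n.-tuple nat * n.-tuple nat) :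
    TID uv -> TID uv' ->
  cubic_le (cubic_of uv) (cubic_of uv') <->
  (forall i, nth 0 uv.1 i <= nth 0 uv'.1 i) /\
  (forall i, nth 0 uv'.2 i <= nth 0 uv.2 i).
Proof.
move=> T T'; split=> [le_c|[le_u le_v] i]; last first.
  rewrite !(tnth_nth 0%R) !nth_cubic_of //.
  by have := le_u i; have := le_v i.+1; lia.
have le_c' i : i.+1 < n ->
    nth 0 uv.1 i <= nth 0 uv'.1 i /\ nth 0 uv'.2 i.+1 <= nth 0 uv.2 i.+1.
  move=> ni; have ni' : i < n.-1 by lia.
  have := le_c (Ordinal ni'); rewrite !(tnth_nth 0%R) !nth_cubic_of //=.
  by have := TID_adjacent T ni; have := TID_adjacent T' ni; lia.
split=> i.
  have [/le_c' []//|h] := ltnP i.+1 n.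
  have [ni|ni] := ltnP i n; last by rewrite nth_default ?size_tuple.
  by have [[/(_ i ni) ? _] _ _] := T; lia.
have [ni|ni] := ltnP i n; last by rewrite nth_default ?size_tuple.
case: i ni => [|i] ni; last by have [] := le_c' i ni.
by have [_ [/(_ 0 ni) ? _] _] := T'; lia.
Qed.

(** * The isomorphism *)

Lemma phi_bij n : set_bij (@CC n) (@TID n) (@phi n).
Proof.
split.
- by move=> _ [uv T <-]; rewrite cubic_ofK.
- move=> _ _ /set_mem[uv T <-] /set_mem[uv' T' <-].
  by rewrite !cubic_ofK // => ->.
- by move=> uv T; exists (cubic_of uv); [exists uv|exact: cubic_ofK].
Qed.

Lemma chi_bij n : set_bij (@TID n) (@interval_posets n) (@chi n).
Proof.
split.
- by move=> uv; exact: chi_interval_poset.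
- by move=> uv uv' /set_mem T /set_mem T'; exact: chi_inj.
- by move=> P /chi_surj[uv T <-]; exists uv.
Qed.

Lemma rho_bij n : set_bij (@interval_posets n) (tamari_intervals n) (@rho n).
Proof.
split.
- move=> _ /chi_surj[uv T <-]; have [st E] := TID_encodes T.
  by rewrite (rho_chi T E); apply/(encodes_interval E).
- move=> _ _ /set_mem/chi_surj[uv T <-] /set_mem/chi_surj[uv' T' <-].
  have [st E] := TID_encodes T; have [st' E'] := TID_encodes T'.
  by rewrite (rho_chi T E) (rho_chi T' E') => /(encodes_inj E E') ->.
- move=> st /[dup] [[Es Et _]] I; have [uv E] := encodes_exists Es Et.
  have T : TID uv by apply/(encodes_interval E).
  by exists (chi uv); [exact: chi_interval_poset|exact: rho_chi].
Qed.

Lemma psiE n (uv : n.-tuple nat * n.-tuple nat) st :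
  TID uv -> encodes uv st -> psi n st = cubic_of uv.
Proof.
move=> T E; rewrite /psi /= -(rho_chi T E).
have [_ phiI _] := phi_bij n; have [chiF chiI _] := chi_bij n.
have [_ rhoI _] := rho_bij n.
rewrite /rho_inv pinvKV ?inE //; last exact: chi_interval_poset.
rewrite /chi_inv pinvKV ?inE // /phi_inv -{1}(cubic_ofK T) pinvKV ?inE //.
by exists uv.
Qed.

Theorem theorem2p4p5 (n : nat) (hn : 1 <= n) :
  [/\ set_bij (@CC n) (@TID n) (@phi n),
      set_bij (@TID n) (@interval_posets n) (@chi n),
      set_bij (@interval_posets n) (tamari_intervals n) (@rho n) &
      poset_isomorphism (tamari_intervals n) interval_le
                        (@CC n) (@cubic_le n) (@psi n)].
Proof.
split; [exact: phi_bij|exact: chi_bij|exact: rho_bij|].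
have code st : tamari_intervals n st ->
    exists2 uv : n.-tuple nat * n.-tuple nat, TID uv & encodes uv st.
  move=> /[dup] [[Es Et _]] I; have [uv E] := encodes_exists Es Et.
  by exists uv => //; apply/(encodes_interval E).
split; first split.
- by move=> st /code[uv T E]; rewrite (psiE T E); exists uv.
- move=> st st' /set_mem/code[uv T E] /set_mem/code[uv' T' E'].
  rewrite (psiE T E) (psiE T' E') => Ec; apply/(encodes_inj E E').
  by rewrite -(cubic_ofK T) -(cubic_ofK T') Ec.
- move=> _ [uv T <-]; have [st E] := TID_encodes T.
  by exists st; [apply/(encodes_interval E)|exact: psiE].
move=> st st' /code[uv T E] /code[uv' T' E'].
rewrite (psiE T E) (psiE T' E') cubic_of_le //.
have [Es Et] := encodes_bsize E; have [Es' Et'] := encodes_bsize E'.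
case: E E' => [E1 E2] [E1' E2']; rewrite -E1 -E2 -E1' -E2' /interval_le.
by rewrite -tamari_le_rvec ?Es // -tamari_le_lvec ?Et.
Qed.
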